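(* Let $\mathbb{T}_1,\mathbb{T}_2$ be time scales that are unbounded above, let $\alpha\in\mathbb{T}_1$, $\beta\in\mathbb{T}_2$, let $[\alpha,\infty)$ be the interval of $\mathbb{T}_1$, and suppose that the interval $[\beta,\infty)\subset\mathbb{T}_2$ consists of isolated points of $\mathbb{T}_2$. If $L\in(C^0_{\mathbb{T}_2}[\beta,\infty),\,C^0_{\mathbb{T}_1}[\alpha,\infty))$, then there exists a function $K:[\alpha,\infty)\times[\beta,\infty)\to\mathbb{R}$ with $K(x,\cdot)\in\mathcal{R}_{\mathbb{T}_2}[\beta,\infty)$ for each $x\in[\alpha,\infty)$ such that $$(Lf)(x)=\int_\beta^\infty K(x,t)f(t)\,\Delta t\qquad\text{for all } f\in C^0_{\mathbb{T}_2}[\beta,\infty)\text{ and } x\in[\alpha,\infty).$$ Moreover, $K$ has the following properties: (i) $\displaystyle\|L\|=\sup_{\alpha\le x<\infty}\int_\beta^\infty |K(x,t)|\,\Delta t<\infty$; (ii) $\displaystyle\lim_{x\to\infty}\int_\beta^y |K(x,t)|\,\Delta t=0$ for all $y\in[\beta,\infty)$.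
   Context: A time scale $\mathbb{T}$ is a nonempty closed subset of $\mathbb{R}$, with the topology inherited from $\mathbb{R}$. All time scales are assumed unbounded above. Intervals are taken in the time scale: $[a,b]=\{t\in\mathbb{T}:a\le t\le b\}$, $[\beta,\infty)=\{t\in\mathbb{T}:t\ge\beta\}$, and similarly for half-open intervals. In the claim, $x$ ranges over the interval $[\alpha,\infty)$ of $\mathbb{T}_1$ and $t,y$ over the interval $[\beta,\infty)$ of $\mathbb{T}_2$. The jump operators are $\sigma(t)=\inf\{s\in\mathbb{T}:s>t\}$ and $\rho(t)=\sup\{s\in\mathbb{T}:s<t\}$. A point $t$ is right-scattered if $\sigma(t)>t$, left-scattered if $\rho(t)<t$, and isolated if it is both. Riemann $\Delta$-integral: for $a<b$ in $\mathbb{T}$, a partition of $[a,b]$ is a finite set $P=\{t_0,\dots,t_n\}\subset[a,b]$ with $a=t_0<t_1<\dots<t_n=b$. For $\delta>0$, $\mathcal{P}_\delta(a,b)$ is the set of partitions such that for each $i\in\{1,\dots,n\}$ either $t_i-t_{i-1}\le\delta$, or $t_i-t_{i-1}>\delta$ and $\rho(t_i)=t_{i-1}$. A Riemann sum of $f$ for $P$ is $S=\sum_{i=1}^n f(\xi_i)(t_i-t_{i-1})$ with arbitrary $\xi_i\in[t_{i-1},t_i)$. The function $f$ is Riemann $\Delta$-integrable on $[a,b]$ with integral $I=\int_a^b f(t)\Delta t$ if for each $\varepsilon>0$ there is $\delta>0$ such that $|S-I|<\varepsilon$ for every Riemann sum $S$ of $f$ corresponding to any $P\in\mathcal{P}_\delta(a,b)$,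 independently of the choice of the $\xi_i$. The improper integral is $\int_a^\infty f(t)\Delta t=\lim_{A\to\infty,\,A\in\mathbb{T}}\int_a^A f(t)\Delta t$ when this limit exists and is finite. $\mathcal{R}_{\mathbb{T}}[\beta,\infty)$ is the set of real-valued functions on $[\beta,\infty)\subset\mathbb{T}$ that are Riemann $\Delta$-integrable on every bounded subinterval of $[\beta,\infty)$. $C^0_{\mathbb{T}}[\beta,\infty)=\{f\in\mathcal{R}_{\mathbb{T}}[\beta,\infty):\lim_{t\to\infty}f(t)=0\}$, equipped with the norm $\|f\|=\sup_{\beta\le t<\infty}|f(t)|$. For normed spaces $X,Y$, $(X,Y)$ denotes the set of bounded linear operators from $X$ to $Y$, and $\|L\|$ is the operator norm. *)

(* Defs.v *)
From HB Require Import structures.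
From mathcomp Require Import all_boot all_order all_algebra.
From mathcomp Require Import all_classical all_reals all_analysis.

Set Implicit Arguments.
Unset Strict Implicit.
Unset Printing Implicit Defensive.

Import Order.TTheory GRing.Theory Num.Theory.
Import numFieldNormedType.Exports.

Local Open Scope classical_set_scope.
Local Open Scope ring_scope.

Record timeScale (R : realType) := TimeScale {
  ts_set :> set R ;
  ts_nonempty : ts_set !=set0 ;
  ts_closed : closed ts_set ;
  ts_unbounded : ~ has_ubound ts_set }.

Section Jumps.
Context (R : realType) (T : timeScale R).

(* The jump operators take values in the extended reals, so that the supremum
   over the empty set is -oo.  Hence the least point of T, if there is one,
   counts as left-scattered, and it is isolated iff it is right-scattered. *)
Definition sigma (t : R) : \bar R := ereal_inf [set s%:E | s in T `&` [set s | t < s]].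
Definition rho (t : R) : \bar R := ereal_sup [set s%:E | s in T `&` [set s | s < t]].

Definition right_scattered (t : R) := (t%:E < sigma t)%E.
Definition left_scattered (t : R) := (rho t < t%:E)%E.
Definition isolated_point (t : R) := right_scattered t /\ left_scattered t.

End Jumps.

(* The interval [c, +oo) of T, for a point c of T; as a set it coerces to the
   type of its elements. *)
Definition ray (R : realType) (T : timeScale R) (c : T) : set R :=
  T `&` [set t | \val c <= t].

Section Ray.
Context (R : realType) (T : timeScale R) (c : T).

Lemma ray_base_subproof : \val c \in ray c.
Proof. by rewrite inE; split => /=; first exact: set_mem (valP c). Qed.

Definition ray_base : ray c := exist _ (\val c) ray_base_subproof.

(* Neighbourhoods of +oo inside [c, +oo). *)
Definition ray_pinfty : set_system (ray c) :=
  [set A | exists M : R, forall t : ray c, M < \val t -> A t].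

Lemma ray_unbounded (M : R) : exists t : ray c, M < \val t.
Proof.
have [t [Tt Mt]] : exists t, ts_set T t /\ Num.max M (\val c) < t.
  apply: contrapT => h; apply: (@ts_unbounded _ T); exists (Num.max M (\val c)).
  by move=> t Tt; rewrite leNgt; apply/negP => Mt; apply: h; exists t.
move: Mt; rewrite gt_max => /andP[Mt ct].
have tc : t \in ray c by rewrite inE; split => //; exact: ltW.
by exists (exist _ t tc).
Qed.

#[global] Instance ray_pinfty_properfilter : ProperFilter ray_pinfty.
Proof.
split; first by move=> [M h]; have [t /h] := ray_unbounded M.
split.
- by exists 0.
- move=> P Q [M hM] [N hN]; exists (Num.max M N) => t.
  by rewrite gt_max => /andP[/hM ? /hN ?].
- by move=> P Q PQ [M hM]; exists M => t /hM /PQ.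
Qed.

(* p 0, ..., p n are the points of a partition; later values are irrelevant.
   When a = b this forces n = 0. *)
Definition is_partition (a b : ray c) (n : nat) (p : nat -> ray c) :=
  [/\ p 0%N = a, p n = b & forall i, (i < n)%N -> \val (p i) < \val (p i.+1)].

(* With is_partition, membership in P_delta(a, b). *)
Definition fine_partition (delta : R) (n : nat) (p : nat -> ray c) :=
  forall i, (i < n)%N ->
    let gap := \val (p i.+1) - \val (p i) in
    gap <= delta \/ (delta < gap /\ rho T (\val (p i.+1)) = (\val (p i))%:E).

Definition tags (n : nat) (p xi : nat -> ray c) :=
  forall i, (i < n)%N -> \val (p i) <= \val (xi i) < \val (p i.+1).

Definition riemann_sum (f : ray c -> R) (n : nat) (p xi : nat -> ray c) : R :=
  \sum_(i < n) f (xi i) * (\val (p i.+1) - \val (p i)).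

(* I is the Riemann Delta-integral of f from a to b, for a <= b. *)
Definition is_Dint (f : ray c -> R) (a b : ray c) (I : R) :=
  forall e : R, 0 < e -> exists2 delta : R, 0 < delta &
    forall n p xi, is_partition a b n p -> fine_partition delta n p ->
      tags n p xi -> `|riemann_sum f n p xi - I| < e.

Definition Dintegrable (f : ray c -> R) (a b : ray c) := exists I, is_Dint f a b I.

(* Junk value 0 when f is not integrable. *)
Definition Dint (f : ray c -> R) (a b : ray c) : R := xget 0 [set I | is_Dint f a b I].

Definition locally_Dintegrable (f : ray c -> R) :=
  forall a b : ray c, \val a <= \val b -> Dintegrable f a b.

Definition is_Dint_infty (f : ray c -> R) (a : ray c) (I : R) :=
  (forall A : ray c, \val a <= \val A -> Dintegrable f a A) /\
  Dint f a A @[A --> ray_pinfty] --> I.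

Definition Dintegrable_infty (f : ray c -> R) (a : ray c) := exists I, is_Dint_infty f a I.

(* Junk value 0 when the improper integral does not exist. *)
Definition Dint_infty (f : ray c -> R) (a : ray c) : R :=
  xget 0 [set I | is_Dint_infty f a I].

Lemma partition_extend (a u v : ray c) (d : R) n p :
  is_partition a u n p -> fine_partition d n p ->
  \val u < \val v ->
  (\val v - \val u <= d \/ (d < \val v - \val u /\ rho T (\val v) = (\val u)%:E)) ->
  exists n' p', is_partition a v n' p' /\ fine_partition d n' p'.
Proof.
move=> [p0 pn pS] fp uv g; exists n.+1, (fun i => if (i <= n)%N then p i else v).
split; first split.
- by [].
- by rewrite ltnn.
- move=> i; rewrite ltnS leq_eqVlt => /orP[/eqP->|lt_in].
    by rewrite /= eqxx ltnn pn.
  by rewrite /= lt_in orbT; exact: pS.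
move=> i; rewrite ltnS leq_eqVlt => /orP[/eqP->|lt_in].
  by rewrite /= eqxx ltnn pn.
by rewrite /= lt_in orbT; exact: fp.
Qed.

Lemma fine_partition_exists (a b : ray c) (d : R) : 0 < d -> \val a <= \val b ->
  exists n p, is_partition a b n p /\ fine_partition d n p.
Proof.
move=> d0 ab.
pose Q (u : ray c) := \val u <= \val b /\
  exists n p, is_partition a u n p /\ fine_partition d n p.
have Qa : Q a by split => //; exists 0%N, (fun=> a).
pose S := [set \val u | u in Q].
have S0 : S !=set0 by exists (\val a), a.
have Sb : ubound S (\val b) by move=> _ [u [ub _] <-].
have Su : has_ubound S by exists (\val b).
have ray_of t : ts_set T t -> \val a <= t -> exists u : ray c, \val u = t.
  move=> Tt at_; have tc : t \in ray c.
    rewrite inE; split => //; apply: le_trans at_.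
    by have /set_mem[] := valP a.
  by exists (exist _ t tc).
have val_ray (u : ray c) : ts_set T (\val u) by have /set_mem[] := valP u.
have Ts : ts_set T (sup S).
  apply: (@ts_closed _ T); apply: (@closure_subset _ S); last exact: closure_sup.
  by move=> _ [u _ <-].
have as_ : \val a <= sup S by apply: ub_le_sup => //; exists a.
have [s sE] := ray_of _ Ts as_.
have sb : \val s <= \val b by rewrite sE; exact: ge_sup.
have Qext (u v : ray c) : Q u -> \val v <= \val b -> \val u < \val v ->
    (\val v - \val u <= d \/ (d < \val v - \val u /\ rho T (\val v) = (\val u)%:E)) -> Q v.
  by move=> [_ [n [p [h1 h2]]]] vb uv g; split=> //; exact: (partition_extend h1 h2 uv g).
have Qs : Q s.
  have [|_ [u Qu <-] us] := @sup_adherent _ S d d0; first by split.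
  rewrite -sE in us.
  have : \val u <= \val s by rewrite sE; apply: ub_le_sup => //; exists u.
  rewrite le_eqVlt => /orP[/eqP/val_inj <-//|us'].
  by apply: (Qext u) => //; left; rewrite lerBlDr addrC -lerBlDr ltW.
have Qmax u : Q u -> \val u <= \val s.
  by move=> Qu; rewrite sE; apply: ub_le_sup => //; exists u.
move: sb; rewrite le_eqVlt => /orP[/eqP/val_inj sb|sb]; first by rewrite sb in Qs; case: Qs.
exfalso.
have nostep (v : ray c) : \val s < \val v -> \val v <= \val b -> d < \val v - \val s.
  move=> sv vb; rewrite ltNge; apply/negP => vsd.
  by have /Qmax := Qext s v Qs vb sv (or_introl vsd); rewrite leNgt sv.
pose A := [set t | ts_set T t /\ \val s < t].
have Ab : A (\val b) by split.
have Al : lbound A (\val s) by move=> t [_ /ltW].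
have hA : has_inf A by split; [exists (\val b)|exists (\val s)].
have Tm : ts_set T (inf A).
  apply: (@ts_closed _ T) => B /nbhs_ballP[e /= e0 eB].
  have [t At te] := inf_adherent e0 hA.
  exists t; split; first by case: At.
  apply: eB; rewrite /ball/= ltr_distlC; apply/andP; split.
    by rewrite (lt_le_trans _ (ge_inf hA.2 At))// ltrBlDr ltrDl.
  exact: te.
have mb : inf A <= \val b by apply: ge_inf => //; exact: hA.2.
have Anostep t : A t -> t <= \val b -> d < t - \val s.
  move=> [Tt st] tb; have [v vE] := ray_of _ Tt (le_trans (Qmax _ Qa) (ltW st)).
  by rewrite -vE; apply: nostep; rewrite vE.
have sdm : \val s + d <= inf A.
  apply: lb_le_inf; first by exists (\val b).
  move=> t At; have [tb|bt] := leP t (\val b).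
    by have := Anostep _ At tb; rewrite ltrBrDr addrC => /ltW.
  by have := Anostep _ Ab (lexx _); rewrite ltrBrDr addrC => /ltW/le_trans; apply; exact: ltW.
have sm : \val s < inf A by apply: lt_le_trans sdm; rewrite ltrDl.
have [m mE] := ray_of _ Tm (le_trans (Qmax _ Qa) (ltW sm)).
have gm : d < \val m - \val s by apply: nostep; rewrite mE.
have : Q m.
  apply: (Qext s) => //; rewrite ?mE//; right; rewrite -mE; split => //.
  apply/eqP; rewrite eq_le; apply/andP; split.
    apply: ge_ereal_sup => _ [t [Tt tm] <-]; rewrite lee_fin leNgt; apply/negP => st.
    by have := ge_inf hA.2 (conj Tt st : A t); rewrite leNgt -mE tm.
  by apply: ereal_sup_ubound; exists (\val s) => //; split; [exact: val_ray|rewrite /= mE].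
by move=> /Qmax; rewrite leNgt mE sm.
Qed.

Lemma is_Dint_unique (f : ray c -> R) (a b : ray c) (I J : R) : \val a <= \val b ->
  is_Dint f a b I -> is_Dint f a b J -> I = J.
Proof.
move=> ab hI hJ; apply/eqP; rewrite -subr_eq0 -normr_le0; apply/ler_addgt0Pr => e e0.
have e20 : 0 < e / 2 by rewrite divr_gt0.
have [d1 d10 h1] := hI _ e20; have [d2 d20 h2] := hJ _ e20.
have [|n [p [pP fp]]] := @fine_partition_exists a b (Num.min d1 d2) _ ab.
  by rewrite lt_min d10.
have tg : tags n p p by case: pP => _ _ pS i /pS ?; rewrite lexx.
have fine d : Num.min d1 d2 <= d -> fine_partition d n p.
  move=> hd i /fp[h|[h1' h2']]; first by left; exact: le_trans hd.
  by have [|] := leP (\val (p i.+1) - \val (p i)) d; [left|right].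
have le1 : Num.min d1 d2 <= d1 by rewrite ge_min lexx.
have le2 : Num.min d1 d2 <= d2 by rewrite ge_min lexx orbT.
have {}h1 := h1 _ _ _ pP (fine _ le1) tg; have {}h2 := h2 _ _ _ pP (fine _ le2) tg.
rewrite add0r; set S := riemann_sum _ _ _ _ in h1 h2.
rewrite (_ : I - J = (S - J) - (S - I)); last by rewrite opprB [RHS]addrC addrA subrK.
by rewrite (le_trans (ler_normB _ _))// (splitr e) lerD// ltW.
Qed.

Lemma DintE (f : ray c -> R) (a b : ray c) (I : R) : \val a <= \val b ->
  is_Dint f a b I -> Dint f a b = I.
Proof. by move=> ab h; apply: xget_subset1 => // J K; exact: is_Dint_unique. Qed.

Lemma is_Dint_inftyE (f : ray c -> R) (a : ray c) (I : R) :
  is_Dint_infty f a I -> Dint_infty f a = I.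
Proof.
move=> h; apply: xget_subset1 => // J K [_ hJ] [_ hK].
by apply: (cvg_unique _ hJ hK); exact: norm_hausdorff.
Qed.

Lemma is_Dint_lin (k : R) (f g : ray c -> R) (a b : ray c) (I J : R) :
  is_Dint f a b I -> is_Dint g a b J -> is_Dint (k *: f + g) a b (k * I + J).
Proof.
move=> hI hJ e e0.
have k0 : 0 < `|k| + 1 by rewrite ltr_wpDl.
have e1 : 0 < e / 2 / (`|k| + 1) by rewrite !divr_gt0.
have e2 : 0 < e / 2 by rewrite divr_gt0.
have [d1 d10 h1] := hI _ e1; have [d2 d20 h2] := hJ _ e2.
exists (Num.min d1 d2); first by rewrite lt_min d10.
move=> n p xi pP fp tg.
have fine d : Num.min d1 d2 <= d -> fine_partition d n p.
  move=> hd i /fp[h|[h1' h2']]; first by left; exact: le_trans hd.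
  by have [|] := leP (\val (p i.+1) - \val (p i)) d; [left|right].
have le1 : Num.min d1 d2 <= d1 by rewrite ge_min lexx.
have le2 : Num.min d1 d2 <= d2 by rewrite ge_min lexx orbT.
have {}h1 := h1 _ _ _ pP (fine _ le1) tg; have {}h2 := h2 _ _ _ pP (fine _ le2) tg.
have -> : riemann_sum (k *: f + g) n p xi
    = k * riemann_sum f n p xi + riemann_sum g n p xi.
  rewrite /riemann_sum mulr_sumr -big_split; apply: eq_bigr => i _ /=.
  by rewrite fctE /= mulrDl mulrA.
rewrite opprD addrACA -mulrBr (le_lt_trans (ler_normD _ _))// (splitr e) ler_ltD//.
rewrite normrM; apply: le_trans (_ : (`|k| + 1) * (e / 2 / (`|k| + 1)) <= _).
  by rewrite ler_pM// ?lerDl// ltW.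
by rewrite mulrC divfK// gt_eqF.
Qed.

Definition in_C0 (f : ray c -> R) :=
  locally_Dintegrable f /\ f t @[t --> ray_pinfty] --> (0 : R).

Lemma in_C0_bounded (f : ray c -> R) : in_C0 f -> has_ubound (range (fun t => `|f t|)).
Proof.
move=> [fI /cvgrPdist_lt/(_ 1 ltr01) [M hM]].
have [b Mb] := ray_unbounded M.
have lb (t : ray c) : \val ray_base <= \val t by have /set_mem[] := valP t.
have [I hI] := fI ray_base b (lb b).
have [d d0 h] := hI 1 ltr01.
have [n [p [pP fp]]] := fine_partition_exists d0 (lb b).
have [p0 pn pS] := pP.
have tg : tags n p p by move=> i /pS ?; rewrite lexx.
pose B := \sum_(i < n) (`|f (p i)| + 2 / (\val (p i.+1) - \val (p i))).
have B0 (i : 'I_n) : 0 <= `|f (p i)| + 2 / (\val (p i.+1) - \val (p i)).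
  by rewrite addr_ge0// divr_ge0// subr_ge0 ltW// pS.
exists (1 + B) => _ [t _ <-].
have [bt|tb] := leP (\val b) (\val t).
  have := hM t (lt_le_trans Mb bt); rewrite sub0r normrN => /ltW/le_trans; apply.
  by rewrite lerDl sumr_ge0.
have [i /andP[pit tpi]] : exists i : 'I_n, \val (p i) <= \val t < \val (p i.+1).
  apply: contrapT => hn.
  have H i : (i <= n)%N -> \val (p i) <= \val t.
    elim: i => [_|i IH lt_in]; first by rewrite p0; exact: lb.
    rewrite leNgt; apply/negP => ti; apply: hn; exists (Ordinal lt_in).
    by rewrite /= ti andbT; apply: IH; exact: ltnW.
  by have := H n (leqnn n); rewrite pn leNgt tb.
have gap0 : 0 < \val (p i.+1) - \val (p i) by rewrite subr_gt0 pS.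
suff ftB : `|f t| <= `|f (p i)| + 2 / (\val (p i.+1) - \val (p i)).
  apply: (le_trans ftB); rewrite /B (bigD1 i)//= addrCA lerDl.
  by rewrite addr_ge0// sumr_ge0.
pose xi (j : nat) := if j == i :> nat then t else p j.
have tx : tags n p xi.
  move=> j jn; rewrite /xi; case: eqP => [->|_]; first by rewrite pit tpi.
  by rewrite lexx pS.
have h1 := h _ _ _ pP fp tg; have h2 := h _ _ _ pP fp tx.
have E : riemann_sum f n p xi - riemann_sum f n p p
    = (f t - f (p i)) * (\val (p i.+1) - \val (p i)).
  rewrite /riemann_sum -sumrB (bigD1 i)//= /xi eqxx big1 ?addr0 ?mulrBl//.
  by move=> j ji; rewrite val_eqE (negbTE ji) subrr.
have : `|(f t - f (p i)) * (\val (p i.+1) - \val (p i))| <= 2.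
  rewrite -E -[X in `|X|](_ : (riemann_sum f n p xi - I) - (riemann_sum f n p p - I) = _);
    last by rewrite opprB addrA subrK.
  by rewrite (le_trans (ler_normB _ _))// -[2]/(1 + 1) lerD// ltW.
rewrite normrM (gtr0_norm gap0) -ler_pdivlMr// => h3.
rewrite -[f t](subrK (f (p i))) addrC (le_trans (ler_normD _ _))//.
by rewrite lerD2l.
Qed.

End Ray.

Arguments ray_base {R T} c.
Arguments ray_pinfty {R T} c.

Section C0.
Context (R : realType) (T : timeScale R) (c : T).

Definition C0_pred : {pred ray c -> R} := mem [set f : ray c -> R | in_C0 f].

Record C0 := MkC0 { C0_fun :> ray c -> R ; C0_funP : C0_fun \in C0_pred }.

HB.instance Definition _ := [isSub for C0_fun].
HB.instance Definition _ := [Choice of C0 by <:].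

Lemma C0_submod_closed : submod_closed C0_pred.
Proof.
split.
  rewrite inE; split; last exact: cvg_cst.
  move=> a b _; exists 0 => e e0; exists 1 => // n p xi _ _ _.
  by rewrite /riemann_sum big1 ?subrr ?normr0// => i _; exact: mul0r.
move=> k f g /[!inE] -[fI f0] [gI g0]; split.
  move=> a b ab; have [I hI] := fI a b ab; have [J hJ] := gI a b ab.
  by exists (k * I + J); exact: is_Dint_lin.
rewrite (_ : 0 = k *: (0 : R) + 0); last by rewrite scaler0 addr0.
by apply: cvgD => //; apply: cvgZr.
Qed.

HB.instance Definition _ := GRing.isSubmodClosed.Build R (ray c -> R) C0_pred
  C0_submod_closed.
HB.instance Definition _ := [SubChoice_isSubLmodule of C0 by <:].

Definition C0_norm (f : C0) : R := sup (range (fun t => `|f t|)).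

Lemma C0_norm_ub (f : C0) (t : ray c) : `|f t| <= C0_norm f.
Proof.
apply: ub_le_sup; last by exists t.
by apply: in_C0_bounded; exact: set_mem (C0_funP f).
Qed.

Lemma C0_norm_le (f : C0) (M : R) : (forall t, `|f t| <= M) -> C0_norm f <= M.
Proof.
move=> h; apply: ge_sup; last by move=> _ [t _ <-].
by exists `|f (ray_base c)|, (ray_base c).
Qed.

Lemma C0_ler_normD (f g : C0) : C0_norm (f + g) <= C0_norm f + C0_norm g.
Proof.
by apply: C0_norm_le => t; rewrite (le_trans (ler_normD _ _))// lerD// C0_norm_ub.
Qed.

Lemma C0_normrZ (k : R) (f : C0) : C0_norm (k *: f) = `|k| * C0_norm f.
Proof.
have le (l : R) (g : C0) : C0_norm (l *: g) <= `|l| * C0_norm g.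
  by apply: C0_norm_le => t; rewrite normrM ler_wpM2l// C0_norm_ub.
apply/eqP; rewrite eq_le le/=; have [->|k0] := eqVneq k 0.
  by rewrite normr0 mul0r (le_trans _ (C0_norm_ub _ (ray_base c))).
rewrite mulrC -ler_pdivlMr ?normr_gt0// mulrC -normfV (le_trans _ (le _ _))//.
by rewrite scalerA mulVf// scale1r.
Qed.

Lemma C0_normr0_eq0 (f : C0) : C0_norm f = 0 -> f = 0.
Proof.
move=> f0; apply/val_inj/funext => t; apply/eqP; rewrite -normr_le0 -f0.
exact: C0_norm_ub.
Qed.

HB.instance Definition _ := Lmodule_isNormed.Build R C0
  C0_ler_normD C0_normrZ C0_normr0_eq0.

Lemma C0_normE (f : C0) : `|f| = sup (range (fun t => `|f t|)).
Proof. by []. Qed.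

End C0.

Section Operators.
Context (R : realType) (X Y : normedModType R).

Definition bounded_operator (L : {linear X -> Y}) :=
  exists M : R, forall v : X, `|L v| <= M * `|v|.

Definition operator_norm (L : {linear X -> Y}) : R :=
  sup [set `|L v| | v in [set v : X | `|v| <= 1]].

End Operators.

(* Main.v *)
Require Import Defs.
From HB Require Import structures.
From mathcomp Require Import all_boot all_order all_algebra.
From mathcomp Require Import all_classical all_reals all_analysis.

Set Implicit Arguments.
Unset Strict Implicit.
Unset Printing Implicit Defensive.

Import Order.TTheory GRing.Theory Num.Theory.
Import numFieldNormedType.Exports.

Local Open Scope classical_set_scope.
Local Open Scope ring_scope.

(** A closed set of isolated points that is unbounded above is discrete in the
    strong sense: its points form one strictly increasing sequence
    u_0 < u_1 < ... tending to infinity ([isolated_ray_enumeration]).  Closedness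
    is what excludes accumulation: a finite limit of the u_n would belong to the
    time scale without being left-scattered.

    On such a ray every Delta-integral is a finite weighted sum, with weights
    w_k = u_{k+1} - u_k ([is_Dint_enum]), because a partition finer than all the
    gaps has to pass through every point.  Thus every function is locally
    integrable, improper integrals are sums of series ([is_Dint_infty_enum]), and
    C0 is in effect the sequence space c_0, whose unit vectors e_k are the
    indicators of the points u_k.

    The theorem then becomes the duality between c_0 and l^1, applied at each x
    to the functional l_x : f |-> (L f)(x).  The truncations
    f(u_0) e_0 + ... + f(u_{n-1}) e_{n-1} converge to f uniformly, so
    l_x(f) is the sum of the f(u_k) l_x(e_k) ([scalar_C0_expansion]); testing l_x
    on the sign vectors of its own coefficients shows that the sum of the
    |l_x(e_k)| is the norm of l_x ([scalar_C0_dual_norm]).  The kernel is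
    K(x, u_k) = l_x(e_k) / w_k, the division cancelling the integration weight.
    Since the norm of L f is a supremum over x, the norm of L is the supremum of
    the norms of the l_x, which is (i).  For (ii), the integral up to u_n is a
    finite sum of the |(L e_k)(x)|, and each L e_k vanishes at infinity. *)

(** * Enumerating a ray of isolated points *)

Definition enumerates (R : realType) (T : timeScale R) (c : T)
    (u : nat -> ray c) :=
  [/\ u 0%N = ray_base c, forall n, \val (u n) < \val (u n.+1)
    & forall t : ray c, exists n, t = u n].

Lemma ray_baseP (R : realType) (T : timeScale R) (c : T) (t : ray c) :
  \val (ray_base c) <= \val t.
Proof. by have /set_mem[] := valP t. Qed.

Lemma ray_mem (R : realType) (T : timeScale R) (c : T) (t : ray c) :
  ts_set T (\val t).
Proof. by have /set_mem[] := valP t. Qed.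

Lemma ray_lift (R : realType) (T : timeScale R) (c : T) (r : R) :
  ts_set T r -> \val c <= r -> exists t : ray c, \val t = r.
Proof.
move=> Tr cr; have rP : r \in ray c by rewrite inE.
by exists (exist _ r rP).
Qed.

(** The infimum of the points beyond [t] belongs to the closed set [T], and right
    scatteredness keeps it away from [t]; so it is the immediate successor. *)
Lemma right_scattered_next (R : realType) (T : timeScale R) (c : T)
    (t : ray c) : right_scattered T (\val t) ->
  exists s : ray c, \val t < \val s /\
    forall r : ray c, \val t < \val r -> \val s <= \val r.
Proof.
pose A := ts_set T `&` [set s | \val t < s].
have A0 : A !=set0.
  by have [r tr] := ray_unbounded c (\val t); exists (\val r); split => //; exact: ray_mem.
have Al : has_lbound A by exists (\val t) => s [_ /ltW].
have Tm : ts_set T (inf A).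
  apply: (@ts_closed _ T) => B /nbhs_ballP[e /= e0 eB].
  have [s As se] := inf_adherent e0 (conj A0 Al).
  exists s; split; first by case: As.
  apply: eB; rewrite /ball/= ltr_distlC se andbT.
  by rewrite (lt_le_trans _ (ge_inf Al As))// ltrBlDr ltrDl.
rewrite /right_scattered /sigma ereal_inf_EFin// lte_fin => tm.
have [s sE] := ray_lift Tm (le_trans (ray_baseP t) (ltW tm)).
exists s; rewrite sE; split => // r tr.
by apply: ge_inf => //; split => //; exact: ray_mem.
Qed.

(** A finite supremum of the sequence would lie in [T] by closedness, while being
    approached strictly from the left by points of [T]. *)
Lemma isolated_ray_unbounded (R : realType) (T : timeScale R) (c : T)
    (u : nat -> ray c) : (forall t : ray c, left_scattered T (\val t)) ->
  (forall n, \val (u n) < \val (u n.+1)) ->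
  forall M, exists n, M < \val (u n).
Proof.
move=> iso uS M; apply: contrapT => uM.
pose S := range (fun n => \val (u n)).
have S0 : S !=set0 by exists (\val (u 0%N)), 0%N.
have Sb : has_ubound S.
  exists M => _ [n _ <-]; rewrite leNgt; apply/negP => ?; by apply: uM; exists n.
have Ts : ts_set T (sup S).
  apply: (@ts_closed _ T); apply: (@closureS _ S); last exact: closure_sup.
  by move=> _ [n _ <-]; exact: ray_mem.
have uSup n : \val (u n) < sup S.
  by apply: lt_le_trans (uS n) _; apply: ub_le_sup => //; exists n.+1.
have [s sE] := ray_lift Ts (le_trans (ray_baseP (u 0%N)) (ltW (uSup 0%N))).
have := iso s; rewrite /left_scattered sE ltNge => /negP; apply.
rewrite -ereal_sup_EFin//; apply: le_ereal_sup => _ [_ [n _ <-] <-].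
by exists (\val (u n)) => //; split; [exact: ray_mem|exact: uSup].
Qed.

Lemma isolated_ray_enumeration (R : realType) (T : timeScale R) (c : T) :
  (forall t : ray c, isolated_point T (\val t)) ->
  exists u : nat -> ray c, enumerates u.
Proof.
move=> iso.
have [next nextP] := choice (fun t => right_scattered_next (iso t).1).
pose u n := iter n next (ray_base c).
have uS n : \val (u n) < \val (u n.+1) by exact: (nextP (u n)).1.
exists u; split => // t.
have [n] := isolated_ray_unbounded (fun t => (iso t).2) uS (\val t).
elim: n => [|n IH] tn; first by rewrite ltNge ray_baseP in tn.
have [/IH//|] := ltP (\val t) (\val (u n)).
rewrite le_eqVlt => /orP[/eqP/val_inj<-|nt]; first by exists n.
by have := (nextP (u n)).2 t nt; rewrite leNgt tn.
Qed.

Lemma enumerates_le (R : realType) (T : timeScale R) (c : T)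
    (u : nat -> ray c) : enumerates u ->
  {mono (fun n => \val (u n)) : m n / (m <= n)%N >-> m <= n}.
Proof. by case=> _ uS _; apply: le_mono; apply: homo_ltn uS; exact: lt_trans. Qed.

Lemma enumerates_lt (R : realType) (T : timeScale R) (c : T)
    (u : nat -> ray c) : enumerates u ->
  {mono (fun n => \val (u n)) : m n / (m < n)%N >-> m < n}.
Proof. by move=> /enumerates_le/leW_mono. Qed.

Lemma enumerates_pinfty (R : realType) (T : timeScale R) (c : T)
    (u : nat -> ray c) : enumerates u ->
  forall M, exists n, forall k, (n <= k)%N -> M < \val (u k).
Proof.
move=> uP M; have [t Mt] := ray_unbounded c M; case: (uP) => _ _ /(_ t)[n tE].
by exists n => k nk; rewrite (lt_le_trans Mt)// tE (enumerates_le uP).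
Qed.

(** * Delta-integrals as weighted sums *)

(** The value at [u k] of the graininess function, sigma(t) - t, when [u]
    enumerates the ray. *)
Definition graininess (R : realType) (T : timeScale R) (c : T)
    (u : nat -> ray c) (k : nat) : R := \val (u k.+1) - \val (u k).

(** Once the mesh is smaller than every gap below [u n], the second alternative
    in the definition of a fine partition must hold at each step.  So the
    partition is exactly u_m, ..., u_n, each tag is the left end of its step, and
    the Riemann sum equals the weighted sum. *)
Lemma is_Dint_enum (R : realType) (T : timeScale R) (c : T)
    (u : nat -> ray c) (f : ray c -> R) (m n : nat) :
  enumerates u -> (m <= n)%N ->
  is_Dint f (u m) (u n) (\sum_(m <= k < n) f (u k) * graininess u k).
Proof.
move=> uP mn e e0.
have le_u := enumerates_le uP; have lt_u := enumerates_lt uP.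
have [u0 uS uT] := uP.
have [d d0 dlt] : exists2 d, 0 < d & forall k, (k < n)%N -> d < graininess u k.
  elim: n {mn} => [|n [d d0 IH]]; first by exists 1.
  exists (Num.min d (graininess u n / 2)).
    by rewrite lt_min d0 divr_gt0// subr_gt0.
  move=> k; rewrite ltnS leq_eqVlt => /orP[/eqP->|/IH h]; rewrite gt_min ?h//.
  by rewrite ltr_pdivrMr// mulr2n mulrDr mulr1 ltrDl subr_gt0 uS orbT.
exists d => // N p xi [p0 pN pS] fp tg.
have [q qE] := choice (fun i => uT (p i)).
have qlt i : (i < N)%N -> (q i < q i.+1)%N.
  by move=> /pS; rewrite !qE lt_u.
have u_inj i j : u i = u j -> i = j.
  by move=> ij; apply/eqP; rewrite eqn_leq -!le_u ij lexx.
have q0 : q 0%N = m by apply: u_inj; rewrite -qE.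
have qN : q N = n by apply: u_inj; rewrite -qE.
have qn i : (i <= N)%N -> (q i <= n)%N.
  move=> iN; rewrite -qN; have := subnKC iN; move: (N - i)%N => j.
  elim: j i {iN} => [|j IH] i; first by rewrite addn0 => ->.
  rewrite addnS -addSn => h; apply: leq_trans (IH _ h); apply/ltnW/qlt.
  by rewrite -h addSn ltnS leq_addr.
(* Consecutive partition points are consecutive points of the enumeration: a
   small step contradicts the choice of d, and for a jump rho leaves no point
   in between. *)
have qS i : (i < N)%N -> q i.+1 = (q i).+1.
  move=> iN; apply/eqP; rewrite eqn_leq qlt// andbT leqNgt; apply/negP => ltq.
  have [] := fp i iN; rewrite !qE.
    have := dlt _ (leq_trans (qlt _ iN) (qn _ iN)).
    rewrite ltNge => /negP + h; apply; apply: le_trans h.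
    by rewrite lerD2r le_u qlt.
  move=> [_ rhoE]; have : ((\val (u (q i).+1))%:E <= rho T (\val (u (q i.+1))))%E.
    apply: ereal_sup_ubound; exists (\val (u (q i).+1)) => //.
    by split; [exact: ray_mem|rewrite /= lt_u].
  by rewrite rhoE lee_fin leNgt uS.
have qD i : (i <= N)%N -> q i = (m + i)%N.
  elim: i => [|i IH] iN; first by rewrite q0 addn0.
  by rewrite qS// IH ?addnS// ltnW.
have xiE i : (i < N)%N -> xi i = u (q i).
  move=> iN; have := tg i iN; have [j ->] := uT (xi i); rewrite !qE le_u lt_u qS//.
  by rewrite ltnS => /andP[h1 h2]; congr u; apply/eqP; rewrite eqn_leq h2.
suff -> : riemann_sum f N p xi = \sum_(m <= k < n) f (u k) * graininess u k.
  by rewrite subrr normr0.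
have nE : n = (m + N)%N by rewrite -qD.
rewrite -{1}[m]add0n big_addn nE addKn big_mkord.
apply: eq_bigr => i _; rewrite xiE// !qE !qD//; last exact: ltnW.
by rewrite /graininess addnS addnC.
Qed.

Lemma Dint_enum (R : realType) (T : timeScale R) (c : T)
    (u : nat -> ray c) (f : ray c -> R) (n : nat) :
  enumerates u ->
  Dint f (ray_base c) (u n) = \sum_(0 <= k < n) f (u k) * graininess u k.
Proof.
move=> uP; have [u0 _ _] := uP; rewrite -u0; apply: DintE.
  by rewrite (enumerates_le uP).
exact: is_Dint_enum.
Qed.

Lemma locally_Dintegrable_enum (R : realType) (T : timeScale R) (c : T)
    (u : nat -> ray c) (f : ray c -> R) :
  enumerates u -> locally_Dintegrable f.
Proof.
move=> uP a b; have [_ _ uT] := uP; have [m ->] := uT a; have [n ->] := uT b.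
by rewrite (enumerates_le uP) => mn; eexists; exact: is_Dint_enum.
Qed.

(** The enumeration is cofinal and exhausts the ray, so limits along the ray are
    limits of sequences. *)
Lemma cvg_ray_pinfty_enum (R : realType) (T : timeScale R) (c : T)
    (u : nat -> ray c) (F : ray c -> R) (l : R) : enumerates u ->
  (F (u n) @[n --> \oo] --> l) <-> (F t @[t --> ray_pinfty c] --> l).
Proof.
move=> uP; have [_ _ uT] := uP; split => /cvgrPdist_lt h; apply/cvgrPdist_lt => e e0.
  have [n _ hn] := h e e0; exists (\val (u n)) => t; have [k ->] := uT t.
  by rewrite (enumerates_lt uP) => /ltnW; exact: hn.
have [M hM] := h e e0; have [n hn] := enumerates_pinfty uP M.
by exists n => // k /= /hn/hM.
Qed.

Lemma is_Dint_infty_enum (R : realType) (T : timeScale R) (c : T)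
    (u : nat -> ray c) (f : ray c -> R) (l : R) : enumerates u ->
  (\sum_(0 <= k < n) f (u k) * graininess u k @[n --> \oo] --> l) <->
  is_Dint_infty f (ray_base c) l.
Proof.
move=> uP; rewrite -(eq_cvg _ _ (fun n => Dint_enum f n uP)).
rewrite (cvg_ray_pinfty_enum (Dint f (ray_base c)) l uP).
by split => [h|[]//]; split => // A ?; apply: (locally_Dintegrable_enum f uP).
Qed.

(** * The space C0 as a sequence space, and its dual *)

Section Evaluation.
Context (R : realType) (T : timeScale R) (c : T).

Definition C0_eval (t : ray c) (f : C0 c) : R := f t.

Lemma C0_eval_linear (t : ray c) : scalar (C0_eval t).
Proof. by []. Qed.

HB.instance Definition _ (t : ray c) :=
  GRing.isLinear.Build R (C0 c) R *%R (C0_eval t) (C0_eval_linear t).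

End Evaluation.

(** The unit vectors of c_0: the indicators of single points, which are integrable
    because every function is, and vanish at infinity because they eventually
    are zero. *)
Lemma enum_basis (R : realType) (T : timeScale R) (c : T)
    (u : nat -> ray c) : enumerates u ->
  exists e : nat -> C0 c, forall k j, e k (u j) = (j == k)%:R.
Proof.
move=> uP.
suff /choice[e eP] : forall k, exists g : C0 c, forall j, g (u j) = (j == k)%:R.
  by exists e.
move=> k.
pose g (t : ray c) : R := (t == u k)%:R.
have gu j : g (u j) = (j == k)%:R.
  by rewrite /g -val_eqE eq_le !(enumerates_le uP) -eqn_leq.
have gP : g \in @C0_pred R T c.
  rewrite inE; split; first exact: locally_Dintegrable_enum uP.
  apply/(cvg_ray_pinfty_enum g 0 uP)/cvgrPdist_lt => d d0.
  by exists k.+1 => // j /= kj; rewrite gu gtn_eqF// subrr normr0.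
by exists (MkC0 gP) => j; exact: gu.
Qed.

Lemma C0_trunc_enum (R : realType) (T : timeScale R) (c : T)
    (u : nat -> ray c) (e : nat -> C0 c) (a : nat -> R) (n j : nat) :
  (forall k j, e k (u j) = (j == k)%:R) ->
  (\sum_(0 <= k < n) a k *: e k) (u j) = if (j < n)%N then a j else 0.
Proof.
move=> eE; rewrite -[LHS]/(C0_eval (u j) _) linear_sum.
transitivity (\sum_(0 <= k < n) (if k == j then a j else 0)).
  apply: eq_bigr => k _; rewrite linearZ /= /C0_eval eE eq_sym.
  by case: eqP => [->|_]; rewrite ?mulr1 ?mulr0.
by rewrite -big_mkcond big_nat1_eq.
Qed.

Lemma C0_norm_enum_le (R : realType) (T : timeScale R) (c : T)
    (u : nat -> ray c) (f : C0 c) (M : R) : enumerates u ->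
  (forall j, `|f (u j)| <= M) -> `|f| <= M.
Proof. by move=> [_ _ uT] h; apply: C0_norm_le => t; have [j ->] := uT t. Qed.

(** The truncations of [f] converge to it uniformly, since what is cut off is the
    tail of a function that tends to 0; a bounded functional then passes to the
    limit. *)
Lemma scalar_C0_expansion (R : realType) (T : timeScale R) (c : T)
    (u : nat -> ray c) (e : nat -> C0 c) (l : {scalar C0 c}) (M : R) (f : C0 c) :
  enumerates u -> (forall k j, e k (u j) = (j == k)%:R) ->
  (forall g, `|l g| <= M * `|g|) ->
  \sum_(0 <= k < n) f (u k) * l (e k) @[n --> \oo] --> l f.
Proof.
move=> uP eE lM; apply/cvgrPdist_le => d d0.
(* |M| + 1 replaces the bound M to make the divisor positive. *)
have M0 : 0 < `|M| + 1 by rewrite ltr_wpDl.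
have /set_mem[_ /(cvg_ray_pinfty_enum f 0 uP)/cvgrPdist_le fu0] := C0_funP f.
have [n _ hn] := fu0 (d / (`|M| + 1)) (divr_gt0 d0 M0).
exists n => // m /= nm.
have -> : \sum_(0 <= k < m) f (u k) * l (e k)
    = l (\sum_(0 <= k < m) f (u k) *: e k).
  by rewrite linear_sum; apply: eq_bigr => k _; rewrite linearZ.
rewrite -linearB (le_trans (lM _))//.
have tail : `|f - \sum_(0 <= k < m) f (u k) *: e k| <= d / (`|M| + 1).
  apply: (C0_norm_enum_le uP) => j.
  rewrite -[X in `|X|]/(f (u j) - (\sum_(0 <= k < m) f (u k) *: e k) (u j)).
  rewrite (C0_trunc_enum _ _ _ eE); case: ltnP => mj.
    by rewrite subrr normr0 divr_ge0// ltW.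
  by have := hn j (leq_trans nm mj); rewrite sub0r normrN subr0.
apply: (@le_trans _ _ ((`|M| + 1) * (d / (`|M| + 1)))).
  apply: (@le_trans _ _ ((`|M| + 1) * `|f - \sum_(0 <= k < m) f (u k) *: e k|)).
    by rewrite ler_wpM2r// (le_trans (ler_norm M))// lerDl.
  by rewrite ler_pM2l.
by rewrite mulrC divfK// gt_eqF.
Qed.

(** Test [l] on the truncated vector of signs of its own coefficients, which lies
    in the unit ball. *)
Lemma scalar_C0_variation (R : realType) (T : timeScale R) (c : T)
    (u : nat -> ray c) (e : nat -> C0 c) (l : {scalar C0 c}) (M : R) (n : nat) :
  enumerates u -> (forall k j, e k (u j) = (j == k)%:R) ->
  (forall g, `|g| <= 1 -> `|l g| <= M) ->
  \sum_(0 <= k < n) `|l (e k)| <= M.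
Proof.
move=> uP eE lM.
have -> : \sum_(0 <= k < n) `|l (e k)|
    = l (\sum_(0 <= k < n) Num.sg (l (e k)) *: e k).
  rewrite linear_sum; apply: eq_bigr => k _.
  by rewrite linearZ /= normrEsg.
apply: le_trans (ler_norm _) (lM _ _); apply: (C0_norm_enum_le uP) => j.
rewrite (C0_trunc_enum _ _ _ eE); case: ifP => _; last by rewrite normr0.
by rewrite normr_sg lern1 leq_b1.
Qed.

(** The isometry between the dual of c_0 and l^1: the last two clauses say that
    the total variation [V] is the least bound for [l] on the unit ball. *)
Lemma scalar_C0_dual_norm (R : realType) (T : timeScale R) (c : T)
    (u : nat -> ray c) (e : nat -> C0 c) (l : {scalar C0 c}) (M : R) :
  enumerates u -> (forall k j, e k (u j) = (j == k)%:R) ->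
  (forall g, `|l g| <= M * `|g|) ->
  exists V, [/\ \sum_(0 <= k < n) `|l (e k)| @[n --> \oo] --> V,
    forall g, `|g| <= 1 -> `|l g| <= V
    & forall N, (forall g, `|g| <= 1 -> `|l g| <= N) -> V <= N].
Proof.
move=> uP eE lM.
pose s n := \sum_(0 <= k < n) `|l (e k)|.
have s_le N : (forall g, `|g| <= 1 -> `|l g| <= N) -> forall n, s n <= N.
  by move=> lN n; apply: scalar_C0_variation uP eE lN.
have s_nd : nondecreasing_seq s.
  by apply/nondecreasing_seqP => n; rewrite /s big_nat_recr //= lerDl.
have s_cvg : cvgn s.
  apply: nondecreasing_is_cvgn => //; exists `|M| => _ [n _ <-].
  apply: s_le => g g1; apply: (le_trans (lM g)).
  by apply: (le_trans (ler_norm _)); rewrite normrM normr_id ler_piMr.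
exists (limn s); split=> //; last first.
  by move=> N /s_le sN; apply: limr_le => //; exact: nearW.
move=> g g1.
have /cvg_norm lg := scalar_C0_expansion (f := g) uP eE lM.
rewrite -(cvg_lim (@norm_hausdorff _ R) lg); apply: limr_le; first exact: (cvgP _ lg).
apply: nearW => n; apply: le_trans (nondecreasing_cvgn_le s_nd s_cvg n).
apply: (le_trans (ler_norm_sum _ _ _)); apply: ler_sum => k _.
by rewrite normrM ler_piMl// (le_trans (C0_norm_ub g (u k))).
Qed.

(** * The kernel of an operator *)

Lemma operator_norm_ub (R : realType) (X Y : normedModType R)
    (L : {linear X -> Y}) (v : X) :
  bounded_operator L -> `|v| <= 1 -> `|L v| <= operator_norm L.
Proof.
move=> [M LM] v1; apply: ub_le_sup; last by exists v.
exists `|M| => _ [w /= w1 <-]; apply: (le_trans (LM w)).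
by apply: (le_trans (ler_norm _)); rewrite normrM normr_id ler_piMr.
Qed.

Lemma cvg_sum_norm0 (R : realType) (T : timeScale R) (c : T)
    (F : nat -> ray c -> R) (n : nat) :
  (forall k, F k x @[x --> ray_pinfty c] --> (0 : R)) ->
  \sum_(0 <= k < n) `|F k x| @[x --> ray_pinfty c] --> (0 : R).
Proof.
move=> F0; elim: n => [|n IH].
  by under eq_fun do rewrite big_nil; exact: cvg_cst.
under eq_fun do rewrite big_nat_recr //=.
have := cvgD IH (cvg_norm (F0 n)); rewrite normr0 addr0; exact.
Qed.

Theorem theorem10 (R : realType) (T1 T2 : timeScale R) (alpha : T1) (beta : T2)
    (isolated_beta : forall t : ray beta, isolated_point T2 (\val t))
    (L : {linear C0 beta -> C0 alpha}) (bounded_L : bounded_operator L) :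
  exists K : ray alpha -> ray beta -> R,
    [/\ forall x, locally_Dintegrable (K x),
        forall (f : C0 beta) (x : ray alpha),
          is_Dint_infty (fun t => K x t * f t) (ray_base beta) (L f x),
        [/\ forall x, Dintegrable_infty (fun t => `|K x t|) (ray_base beta),
            has_ubound (range (fun x => Dint_infty (fun t => `|K x t|) (ray_base beta)))
          & operator_norm L
              = sup (range (fun x => Dint_infty (fun t => `|K x t|) (ray_base beta)))]
      & forall y : ray beta,
          (forall x, Dintegrable (fun t => `|K x t|) (ray_base beta) y) /\
          Dint (fun t => `|K x t|) (ray_base beta) y @[x --> ray_pinfty alpha] --> (0 : R)].
Proof.
have [u uP] := isolated_ray_enumeration isolated_beta.
have [e eE] := enum_basis uP.
have [_ uS uT] := uP.
have [idx idxE] := choice uT.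
have idxu k : idx (u k) = k.
  by apply/eqP; rewrite eqn_leq -!(enumerates_le uP) -idxE lexx.
have w0 k : 0 < graininess u k by rewrite subr_gt0.
pose l x : {scalar C0 beta} := C0_eval x \o L.
(* idx t is the rank of the point t; dividing by the graininess cancels the
   weight with which the integral counts that point. *)
pose K x t := l x (e (idx t)) / graininess u (idx t).
have Kw x k : K x (u k) * graininess u k = l x (e k).
  by rewrite /K idxu divfK// gt_eqF.
have absKw x k : `|K x (u k)| * graininess u k = `|l x (e k)|.
  by rewrite -Kw [RHS]normrM (gtr0_norm (w0 k)).
have [M LM] := bounded_L.
have lM x g : `|l x g| <= M * `|g| by apply: le_trans (LM g); exact: C0_norm_ub.
have [V VP] := choice (fun x => scalar_C0_dual_norm uP eE (lM x)).
have KV x : is_Dint_infty (fun t => `|K x t|) (ray_base beta) (V x).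
  apply/(is_Dint_infty_enum _ _ uP); have [+ _ _] := VP x.
  by apply: cvg_trans; apply: near_eq_cvg; apply: nearW => n; apply: eq_bigr => k _.
have VE x : Dint_infty (fun t => `|K x t|) (ray_base beta) = V x.
  exact: is_Dint_inftyE.
have V_le x : V x <= operator_norm L.
  have [_ _] := VP x; apply=> g g1; apply: le_trans (operator_norm_ub bounded_L g1).
  exact: C0_norm_ub.
have V_ub : has_ubound (range V) by exists (operator_norm L) => _ [x _ <-].
exists K; split.
- by move=> x; exact: locally_Dintegrable_enum uP.
- move=> f x; apply/(is_Dint_infty_enum _ _ uP).
  apply: cvg_trans (scalar_C0_expansion (f := f) uP eE (lM x)).
  apply: near_eq_cvg; apply: nearW => n; apply: eq_bigr => k _.
  by rewrite mulrAC Kw mulrC.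
- under [in X in has_ubound X]eq_fun do rewrite VE.
  under [in X in sup X]eq_fun do rewrite VE.
  split=> //; first by move=> x; exists (V x).
  apply/eqP; rewrite eq_le; apply/andP; split; last first.
    by apply: ge_sup => [|_ [x _ <-]//]; exists (V (ray_base alpha)), (ray_base alpha).
  apply: ge_sup; first by exists `|L 0|, 0; rewrite //= normr0.
  move=> _ [g /= g1 <-]; apply: C0_norm_le => x.
  have [_ + _] := VP x; move=> /(_ g g1)/le_trans; apply.
  by apply: ub_le_sup => //; exists x.
- move=> y; split=> [x|].
    by apply: (locally_Dintegrable_enum _ uP); exact: ray_baseP.
  have [n ->] := uT y.
  under eq_fun do rewrite (Dint_enum _ _ uP).
  under eq_fun do under eq_bigr do rewrite absKw.
  apply: (cvg_sum_norm0 (F := fun k x => l x (e k))) => k.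
  by have /set_mem[] := C0_funP (L (e k)).
Qed.
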